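(* For $u^\dagger\in\mathcal X$, the size of the MAP test $\Psi_{\mathrm{MAP}}$ is given by $$\mathbb P_{u^\dagger}\left[\Psi_{\mathrm{MAP}}(Y)=1\right]=Q\left(\frac{\langle u^\dagger,T^*\Phi_{\mathrm{MAP}}\rangle_{\mathcal X}-\langle m_0,T^*\Phi_{\mathrm{MAP}}-\varphi\rangle_{\mathcal X}}{\sigma\|\Phi_{\mathrm{MAP}}\|_{\mathcal Y}}\right)$$ with $$\Phi_{\mathrm{MAP}}:=TC_0^{1/2}\left(C_0^{1/2}T^*TC_0^{1/2}+\sigma^2\mathrm{Id}\right)^{-1}C_0^{1/2}\varphi,$$ where $Q$ denotes the cumulative distribution function of the standard normal distribution.
   Context: $\mathcal X,\mathcal Y$ are real separable Hilbert spaces, $\varphi$ is a bounded linear functional on $\mathcal X$ (identified with an element of $\mathcal X$), $T:\mathcal X\to\mathcal Y$ is bounded linear with adjoint $T^*$, $\sigma>0$, $m_0\in\mathcal X$, and $C_0$ is a self-adjoint, positive definite, trace class operator on $\mathcal X$. $Z$ is Gaussian white noise on $\mathcal Y$: a family $(Z(g))_{g\in\mathcal Y}$ of centered, jointly Gaussian random variables, linear in $g$, with $\mathbb E[Z(g)Z(h)]=\langle g,h\rangle_{\mathcal Y}$. For $u\in\mathcal X$, $\mathbb P_u$ denotes the law of the data $Y=Tu+\sigma Z$, i.e. $Y(g)=\langle Tu,g\rangle_{\mathcal Y}+\sigma Z(g)$; realizations $y$ of $Y$ are linear functionals on $\mathcal Y$, and $\langle y,g\rangle:=y(g)$. The size of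 a test $\Psi$ (a measurable map from the data to $\{0,1\}$) at $u^\dagger$ is $\mathbb P_{u^\dagger}[\Psi(Y)=1]$. For the Bayesian model with prior $\Pi=\mathcal N(m_0,C_0)$ (independent of $Z$), the posterior is almost surely the Gaussian measure $\Pi(\cdot|Y=y)=\mathcal N(m,C)$ on $\mathcal X$ with $C=\sigma^2C_0^{1/2}(C_0^{1/2}T^*TC_0^{1/2}+\sigma^2\mathrm{Id})^{-1}C_0^{1/2}$ and $m=m_0+C_0^{1/2}(C_0^{1/2}T^*TC_0^{1/2}+\sigma^2\mathrm{Id})^{-1}C_0^{1/2}T^*(y-Tm_0)$, where $C_0^{1/2}T^*y\in\mathcal X$ is the Riesz representer of $x\mapsto y(TC_0^{1/2}x)$. Put $\mathcal X_H=\{x\in\mathcal X:\langle\varphi,x\rangle\le0\}$, $\mathcal X_K=\{x\in\mathcal X:\langle\varphi,x\rangle>0\}$. The maximum a posteriori (MAP) test is $\Psi_{\mathrm{MAP}}(y)=1$ if $\Pi(\mathcal X_K|Y=y)>\Pi(\mathcal X_H|Y=y)$ and $\Psi_{\mathrm{MAP}}(y)=0$ otherwise. *)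

(* Defs.v *)
From HB Require Import structures.
From mathcomp Require Import all_boot all_order all_algebra.
From mathcomp Require Import all_classical all_reals all_analysis.
From mathcomp Require Import measurable_realfun.

Set Implicit Arguments.
Unset Strict Implicit.
Unset Printing Implicit Defensive.

Import Order.TTheory GRing.Theory Num.Theory.
Import numFieldNormedType.Exports.

Local Open Scope classical_set_scope.
Local Open Scope ring_scope.

(* Real Hilbert spaces: complete normed spaces whose norm comes from an inner
   product.  Positive definiteness of [inner] follows from [inner_norm]. *)
HB.mixin Record CompleteNormedModule_isHilbert (R : realType) H
    of CompleteNormedModule R H := {
  inner : H -> H -> R;
  innerC : forall x y : H, inner x y = inner y x;
  inner_linearl : forall y : H, scalar (fun x : H => inner x y);
  inner_norm : forall x : H, inner x x = `|x| ^+ 2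
}.

#[short(type="hilbertType")]
HB.structure Definition Hilbert (R : realType) :=
  {H of CompleteNormedModule R H & CompleteNormedModule_isHilbert R H}.

Definition separable (T : topologicalType) : Prop :=
  exists D : set T, countable D /\ dense D.

Section Operators.
Context {R : realType}.

Definition is_adjoint (X Y : hilbertType R) (T : X -> Y) (Ts : Y -> X) : Prop :=
  forall x y, inner (T x) y = inner x (Ts y).

Definition self_adjoint (X : hilbertType R) (A : X -> X) : Prop :=
  is_adjoint A A.

Definition positive_definite (X : hilbertType R) (A : X -> X) : Prop :=
  forall x, x != 0 -> 0 < inner (A x) x.

(* S is the nonnegative square root of A. *)
Definition is_sqrt_op (X : hilbertType R) (A : X -> X) (S : {linear X -> X}) :
    Prop :=
  [/\ continuous S, self_adjoint S, (forall x, 0 <= inner (S x) x)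
    & forall x, S (S x) = A x].

Definition hilbert_basis (X : hilbertType R) (B : set X) : Prop :=
  (forall x y, B x -> B y -> inner x y = (x == y)%:R) /\
  (forall x, (forall b, B b -> inner x b = 0) -> x = 0).

(* tr |A| < +oo, where |A| is the square root of A^* A. *)
Definition trace_class (X : hilbertType R) (A : X -> X) : Prop :=
  exists As Aabs : {linear X -> X}, exists B : set X,
    [/\ is_adjoint A As, is_sqrt_op (As \o A) Aabs, hilbert_basis B
      & (\esum_(e in B) (inner (Aabs e) e)%:E < +oo)%E].

(* Forward operator T, its adjoint Ts, and the square root S of the prior
   covariance: S T^* T S + sigma^2 Id. *)
Definition regularized_op (X Y : hilbertType R) (T : X -> Y) (Ts : Y -> X)
    (S : X -> X) (sigma : R) : X -> X :=
  fun x => S (Ts (T (S x))) + sigma ^+ 2 *: x.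

End Operators.

Section GaussianMeasures.
Context {R : realType}.

(* N(m, v) on the line, with v the variance.  The case v = 0 is treated apart
   because [normal_prob m 0] is not a Dirac mass. *)
Definition normal_law (m v : R) (A : set R) : \bar R :=
  if v == 0 then dirac m A else normal_prob m (Num.sqrt v) A.

(* Q: cumulative distribution function of N(0, 1). *)
Definition std_normal_cdf (x : R) : \bar R := normal_prob 0 1 `]-oo, x].

Definition borel (X : hilbertType R) := g_sigma_algebraType (@open X).

(* mu = N(m, C): for every h, the law of x |-> <x, h> under mu is
   N(<m, h>, <C h, h>). *)
Definition is_gaussian_measure (X : hilbertType R) (m : X) (C : X -> X)
    (mu : set (borel X) -> \bar R) : Prop :=
  forall (h : X) (A : set R), measurable A ->
    mu [set x : X | A (inner x h)] = normal_law (inner m h) (inner (C h) h) A.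

End GaussianMeasures.

Section Data.
Context {R : realType}.

(* Data space: real functions on Y (realizations are linear functionals) with
   the sigma-algebra generated by the evaluations y |-> y g. *)
Definition cylinder (Y : hilbertType R) : set (set (Y -> R)) :=
  [set B | exists (g : Y) (A : set R), measurable A /\ B = [set y | A (y g)]].

Definition data (Y : hilbertType R) := g_sigma_algebraType (@cylinder Y).

Context {d : measure_display} {Omega : measurableType d}.
Variable P : probability Omega R.

Definition is_white_noise (Y : hilbertType R) (Z : Y -> {RV P >-> R}) : Prop :=
  [/\ forall w, scalar (fun g => Z g w),
      forall g, 'E_P[Z g]%E = 0%E,
      forall (n : nat) (g : 'I_n -> Y) (a : 'I_n -> R),
        exists m v : R, 0 <= v /\
          forall A : set R, measurable A ->
            P [set w | A (\sum_(i < n) a i * Z (g i) w)] = normal_law m v A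
    & forall g h, 'E_P[Z g \* Z h]%E = (inner g h)%:E].

Variables (X Y : hilbertType R) (T : X -> Y) (sigma : R).
Variable Z : Y -> {RV P >-> R}.

Definition observe (u : X) (w : Omega) : data Y :=
  fun g => inner (T u) g + sigma * Z g w.

Lemma measurable_observe (u : X) : measurable_fun [set: Omega] (observe u).
Proof.
apply: measurability => [//|] _ [_ [g [A [mA ->]]] <-].
rewrite setTI.
have mf : measurable_fun [set: Omega]
    (fun w => inner (T u) g + sigma * Z g w : R).
  by apply: measurable_funD => //; apply: measurable_funM.
by have := mf measurableT A mA; rewrite setTI.
Qed.

HB.instance Definition _ (u : X) :=
  isMeasurableFun.Build _ _ _ _ (observe u) (measurable_observe u).

(* P_u, the law of the data Y = T u + sigma Z. *)
Definition data_law (u : X) : probability (data Y) R :=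
  distribution P (observe u).

(* Post is a version of the posterior for the Bayesian model in which the
   unknown has law [prior] and is independent of Z, i.e. the joint law of
   unknown and data is prior(du) P_u(dy). *)
Definition is_posterior (prior : probability (borel X) R)
    (Post : R.-pker (data Y) ~> (borel X)) : Prop :=
  forall (A : set (borel X)) (B : set (data Y)), measurable A -> measurable B ->
    (\int[prior]_(u in A) data_law u B =
     \int[prior]_u \int[data_law u]_(y in B) Post y A)%E.

End Data.

Section Posterior.
Context {R : realType} (X Y : hilbertType R).
Variables (T : X -> Y) (S : X -> X) (sigma : R) (m0 : X).
(* The inverse of [regularized_op T Ts S sigma]. *)
Variable Ainv : X -> X.

Definition posterior_cov : X -> X := fun x => sigma ^+ 2 *: S (Ainv (S x)).

(* m = m_0 + S (S T^* T S + sigma^2 Id)^-1 r, where r = S T^* (y - T m_0) is the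
   Riesz representer of x |-> y (T S x) - <T m_0, T S x>.  The representer need
   not exist for every y, hence a relation between y and m. *)
Definition is_posterior_mean (y : data Y) (m : X) : Prop :=
  exists r : X,
    (forall x : X, inner r x = y (T (S x)) - inner (T m0) (T (S x))) /\
    m = m0 + S (Ainv r).

Definition half_H (phi : X) : set (borel X) := [set x : X | inner phi x <= 0].
Definition half_K (phi : X) : set (borel X) := [set x : X | 0 < inner phi x].

Definition MAP_test (Post : R.-pker (data Y) ~> (borel X)) (phi : X)
    (y : data Y) : bool :=
  (Post y (half_H phi) < Post y (half_K phi))%E.

Definition Phi_MAP (phi : X) : Y := T (S (Ainv (S phi))).

End Posterior.

(* Main.v *)
(* Almost surely the posterior law of <phi, .> is a normal law with variance
   <C phi, phi> > 0, so the posterior charges { <phi, .> > 0 } more than its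
   complement exactly when the posterior mean m satisfies <phi, m> > 0.  As
   (S T^* T S + sigma^2 Id)^-1 is symmetric, <phi, m> = y(Phi) - <m0, T^* Phi - phi>
   with Phi = Phi_MAP: the test compares one coordinate of the data to a
   threshold.  Under P_u this coordinate is <u, T^* Phi> + sigma Z(Phi), and Z(Phi)
   is N(0, |Phi|^2), since a normal law is determined by its mean and its second
   moment. *)
Require Import Defs.
From HB Require Import structures.
From mathcomp Require Import all_boot all_order all_algebra.
From mathcomp Require Import all_classical all_reals all_analysis.
From mathcomp Require Import measurable_realfun.
From mathcomp Require Import ring lra.

Set Implicit Arguments.
Unset Strict Implicit.
Unset Printing Implicit Defensive.

Import Order.TTheory GRing.Theory Num.Theory.
Import numFieldNormedType.Exports.

Local Open Scope classical_set_scope.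
Local Open Scope ring_scope.

(** * Affine changes of variable for Lebesgue measure and normal laws *)

Section normal_affine.
Context {R : realType}.
Implicit Types (m s x : R) (A : set R).
Local Notation mu := (@lebesgue_measure R).

Lemma measurable_affine m s :
  measurable_fun [set: measurableTypeR R]
    ((fun x => s * x + m) : measurableTypeR R -> measurableTypeR R).
Proof. by apply: measurable_funD => //; exact: measurable_funM. Qed.

(* The measurability proof is an argument of the canonical measure structure of
   [pushforward] that unification does not find, hence the explicit instance. *)
Definition affine_image m s : {measure set (measurableTypeR R) -> \bar R} :=
  measure_function_pushforward__canonical__measure_function_Measure mu
    (measurable_affine m s).

(** By uniqueness of Lebesgue measure, it suffices to compare the two sides on half-open
    intervals. *)
Lemma lebesgue_measure_affine m s A : s != 0 -> measurable A ->
  mu A = (`|s|%:E * mu ((fun x => (s * x + m)%R) @^-1` A))%E.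
Proof.
move=> s0 mA.
pose nu : {measure set (measurableTypeR R) -> \bar R} :=
  mscale (NngNum (normr_ge0 s)) (affine_image m s).
suff -> : mu A = nu A by [].
apply: (@lebesgue_measure_unique R nu) => //= _ [[a b]] _ <-.
rewrite /nu /= /mscale /= /pushforward.
rewrite lebesgue_measure_itv/= lte_fin.
have [s_gt0|s_lt0] := ltrP 0 s.
  rewrite (_ : _ @^-1` _ = `](a - m) / s, (b - m) / s]%classic); last first.
    apply/seteqP; split => x /=; rewrite !in_itv /=;
    by rewrite ltr_pdivrMr// ler_pdivlMr// ltrBlDr lerBrDr mulrC.
  rewrite lebesgue_measure_itv/= lte_fin ltr_pM2r ?invr_gt0// ltrD2r.
  case: ifPn => ab; last by rewrite mule0.
  by rewrite -!EFinD -EFinM gtr0_norm//; congr (_%:E); field.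
have {s_lt0}s_lt0 : s < 0 by rewrite lt_neqAle s0.
(* A negative slope reverses the interval, so its closed end is now the left one; its length is not
   affected. *)
rewrite (_ : _ @^-1` _ = `[(b - m) / s, (a - m) / s[%classic); last first.
  apply/seteqP; split => x /=; rewrite !in_itv /=;
  by rewrite ltr_ndivlMr// ler_ndivrMr// ltrBlDr lerBrDr mulrC andbC.
rewrite lebesgue_measure_itv/= lte_fin ltr_nM2r ?invr_lt0// ltrD2r.
case: ifPn => ab; last by rewrite mule0.
by rewrite -!EFinD -EFinM ltr0_norm//; congr (_%:E); field.
Qed.

Lemma normal_pdf_affine m s x : s != 0 ->
  normal_pdf 0 1 x = `|s| * normal_pdf m s (s * x + m).
Proof.
move=> s0.
rewrite !normal_pdfE ?oner_neq0// /normal_peak /normal_fun addrK.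
rewrite mulrA; congr (_ * expR _); last by rewrite subr0; field.
rewrite expr1n mul1r -mulrnAr sqrtrM ?sqr_ge0// sqrtr_sqr invfM mulrA.
by rewrite divff ?mul1r// normr_eq0.
Qed.

(** Reduces questions about normal laws to N(0, 1). Negative [s] is allowed, so that [s = -1] can
    yield the symmetry of N(0, 1). *)
Lemma normal_prob_affine m s A : s != 0 -> measurable A ->
  normal_prob m s A = normal_prob 0 1 ((fun x => s * x + m) @^-1` A).
Proof.
move=> s0 mA; rewrite /normal_prob.
have mF := measurable_affine m s.
transitivity (\int[mscale (NngNum (normr_ge0 s)) (affine_image m s)]_(x in A)
    (normal_pdf m s x)%:E)%E.
  apply: eq_measure_integral => B mB _; exact: (lebesgue_measure_affine m s0).
have mp : measurable_fun A (fun x => (normal_pdf m s x)%:E).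
  by apply/measurable_funTS/measurable_EFinP; exact: measurable_normal_pdf.
rewrite ge0_integral_mscale//; last by move=> x _; rewrite lee_fin normal_pdf_ge0.
rewrite ge0_integral_pushforward//=; last first.
  by move=> x _; rewrite lee_fin normal_pdf_ge0.
rewrite -ge0_integralZl//=.
- by apply: eq_integral => x _; rewrite (normal_pdf_affine m x s0) EFinM.
- by rewrite -[X in measurable X]setTI; exact: mF.
- apply/measurable_funTS/measurable_EFinP.
  by apply: (measurableT_comp (measurable_normal_pdf m s)).
- by move=> x _; rewrite lee_fin normal_pdf_ge0.
Qed.

End normal_affine.

(** * The second moment of the standard normal law *)

Section second_moment.
Context {R : realType}.
Local Notation mu := (@lebesgue_measure R).
Local Notation pdf := (@normal_pdf R 0 1).

(** The Radon-Nikodym derivative and [normal_pdf] have the same integral over every measurable set,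
    hence agree almost everywhere. *)
Lemma ge0_integral_normal_prob (m s : R) (f : R -> \bar R) :
  measurable_fun [set: R] f -> (forall x, 0 <= f x)%E ->
  (\int[normal_prob m s]_x f x = \int[mu]_x (f x * (normal_pdf m s x)%:E))%E.
Proof.
move=> mf f0.
have dom := normal_prob_dominates m s.
rewrite -(Radon_Nikodym_SigmaFinite.change_of_variables dom)//=.
have intRN := Radon_Nikodym_SigmaFinite.f_integrable dom.
apply: ae_eq_integral => //.
- by apply: emeasurable_funM => //; exact: (measurable_int mu).
- apply: emeasurable_funM => //; apply/measurable_EFinP.
  exact: measurable_normal_pdf.
- apply: ae_eqe_mul2l; apply: integral_ae_eq => //=.
  + by apply/measurable_EFinP; exact: measurable_normal_pdf.
  + by move=> E _ mE; rewrite -Radon_Nikodym_SigmaFinite.f_integral.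
Qed.

Lemma is_derive_pdf (x : R) : is_derive x 1 pdf (- x * pdf x).
Proof.
rewrite normal_pdfE ?oner_neq0// /normal_fun.
apply: is_derive_eq; rewrite /GRing.scale /= !subr0 expr1n.
by field.
Qed.

Lemma is_derive_id_pdf (x : R) :
  is_derive x 1 (fun x => x * pdf x) ((1 - x ^+ 2) * pdf x).
Proof.
have ? := is_derive_pdf x.
apply: is_derive_eq; rewrite /GRing.scale /=; ring.
Qed.

Lemma cvg_id_pdf : (fun x => x * pdf x) x @[x --> +oo] --> (0 : R).
Proof.
(* The upper bound comes from exp t >= 1 + t at t = x^2 / 2, which gives x exp(- x^2 / 2) <= 2 / x
   for x > 0. *)
apply: (@squeeze_cvgr _ _ _ _ (cst 0) (fun x => normal_peak 1 * (2 * x^-1))).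
- near=> x.
  have x0 : 0 < x by [].
  rewrite mulr_ge0 ?normal_pdf_ge0 ?(ltW x0)//=.
  rewrite normal_pdfE ?oner_neq0// /normal_fun mulrCA.
  rewrite ler_pM2l ?normal_peak_gt0 ?oner_neq0//.
  rewrite subr0 expr1n mulNr expRN ler_pdivrMr ?expR_gt0//.
  rewrite mulrAC -mulrA -ler_pdivrMl ?ltr0n//.
  rewrite ler_pdivlMr//.
  have := expR_ge1Dx (x ^+ 2 / 2); lra.
- exact: cvg_cst.
- rewrite -[X in _ --> X](mulr0 (normal_peak 1)); apply: cvgMr.
  rewrite -[X in _ --> X](mulr0 2); apply: cvgMr.
  apply/gtr0_cvgV0; last exact: cvg_id.
  exact: nbhs_pinfty_gt.
Unshelve. all: by end_near. Qed.

Let cpdf : continuous pdf.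
Proof. by apply: continuous_normal_pdf; rewrite oner_neq0. Qed.

Let cid_pdf : continuous (fun x : R => x * pdf x).
Proof. by move=> x; apply: cvgM; [exact: cvg_id|exact: cpdf]. Qed.

Let csqr_pdf : continuous (fun x : R => x ^+ 2 * pdf x).
Proof. by move=> x; apply: cvgM; [exact: sqr_continuous|exact: cpdf]. Qed.

Let cder_pdf : continuous (fun x : R => (1 - x ^+ 2) * pdf x).
Proof.
move=> x; apply: cvgM; last exact: cpdf.
by apply: (@cvgB _ R^o); [exact: cvg_cst|exact: sqr_continuous].
Qed.

(* The second moment comes from the antiderivative [x * pdf x] of
   [(1 - x ^+ 2) * pdf x]; the half-line is cut at 1, where the sign changes,
   so that only integrals of nonnegative functions are added. *)
Let integral_01 :
  (\int[mu]_(x in `[0%R, 1%R]) ((1 - x ^+ 2) * pdf x)%:E = (pdf 1)%:E)%E.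
Proof.
rewrite (@continuous_FTC2 _ _ (fun x => x * pdf x))//.
- by rewrite mul1r mul0r sube0.
- exact: continuous_subspaceT.
- split.
  + by move=> x _; have [] := is_derive_id_pdf x.
  + exact/cvg_at_right_filter/cid_pdf.
  + exact/cvg_at_left_filter/cid_pdf.
- by move=> x _; rewrite derive1E; have [_ ->] := is_derive_id_pdf x.
Qed.

Let integral_1y :
  (\int[mu]_(x in `[1%R, +oo[) ((x ^+ 2 - 1) * pdf x)%:E = (pdf 1)%:E)%E.
Proof.
have der (x : R) : is_derive x 1 (fun x => - (x * pdf x)) ((x ^+ 2 - 1) * pdf x).
  have ? := is_derive_id_pdf x.
  by apply: is_derive_eq; ring.
rewrite (@ge0_continuous_FTC2y _ _ (fun x => - (x * pdf x)) _ 0)//.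
- by rewrite mul1r sub0e EFinN oppeK.
- move=> x x1; rewrite mulr_ge0 ?normal_pdf_ge0// subr_ge0.
  by rewrite -[leLHS](expr1n _ 2) lerXn2r// nnegrE// (le_trans _ x1).
- apply: continuous_subspaceT => x; apply: cvgM; last exact: cpdf.
  by apply: (@cvgB _ R^o); [exact: sqr_continuous|exact: cvg_cst].
- rewrite -[X in _ --> X]oppr0; exact: (cvgN cvg_id_pdf).
- apply: cvgN; exact/cvg_at_right_filter/cid_pdf.
- by move=> x _; rewrite derive1E; have [_ ->] := der x.
Qed.

Let mpdf (D : set R) : measurable_fun D (fun x => (pdf x)%:E).
Proof.
by apply: measurable_funTS; apply/measurable_EFinP; exact: measurable_normal_pdf.
Qed.

Let msqr_pdf (D : set R) : measurable_fun D (fun x => (x ^+ 2 * pdf x)%:E).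
Proof.
apply/measurable_funTS/measurable_EFinP/measurable_funM => //.
exact: measurable_normal_pdf.
Qed.

Let mpoly_pdf (p : R -> R) (D : set R) : measurable_fun [set: R] p ->
  measurable_fun D (fun x => (p x * pdf x)%:E).
Proof.
move=> mp; apply: measurable_funTS; apply/measurable_EFinP/measurable_funM => //.
exact: measurable_normal_pdf.
Qed.

Let integral_0y_split (f : R -> \bar R) : measurable_fun [set: R] f ->
  (forall x, 0 <= f x)%E ->
  (\int[mu]_(x in [set x | (0 <= x)%R]) f x =
   \int[mu]_(x in `[0%R, 1%R]) f x + \int[mu]_(x in `[1%R, +oo[) f x)%E.
Proof.
(* The second interval is opened at 1 to make the two pieces disjoint. *)
move=> mf f0; rewrite -(@integral_itv_obnd_cbnd _ 1); last exact: measurable_funTS.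
rewrite -ge0_integral_setU//=; last 2 first.
- exact: measurable_funTS.
- apply/disj_set2P; rewrite -subset0 => x [] /=; rewrite !in_itv/=.
  by move=> /andP[_ x1]; rewrite andbT ltNge x1.
congr integral; apply/seteqP; split => x /=; rewrite !in_itv/= andbT.
  by move=> ->; case: (leP x 1) => _; [left|right].
by move=> [/andP[]//|/ltW]; exact: le_trans.
Qed.

(** Replacing [pdf x] by [x ^+ 2 * pdf x] loses [pdf 1] on [0, 1] and gains [pdf 1] on [1, +oo[, so
    the changes cancel. *)
Let integral_sqr_pdf_0y :
  (\int[mu]_(x in [set x | (0 <= x)%R]) (x ^+ 2 * pdf x)%:E =
   \int[mu]_(x in [set x | (0 <= x)%R]) (pdf x)%:E)%E.
Proof.
have pdf0 x : (0 <= (pdf x)%:E)%E by rewrite lee_fin normal_pdf_ge0.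
have sqr0 x : (0 <= (x ^+ 2 * pdf x)%:E)%E.
  by rewrite lee_fin mulr_ge0 ?sqr_ge0 ?normal_pdf_ge0.
rewrite !integral_0y_split//.
have -> : (\int[mu]_(x in `[0%R, 1%R]) (pdf x)%:E =
    \int[mu]_(x in `[0%R, 1%R]) (x ^+ 2 * pdf x)%:E + (pdf 1)%:E)%E.
  rewrite -integral_01 -ge0_integralD//=.
  - by apply: eq_integral => x _; rewrite -EFinD; congr (_%:E); ring.
  - exact: msqr_pdf.
  - move=> x; rewrite in_itv/= => /andP[x0 x1].
    by rewrite lee_fin mulr_ge0 ?normal_pdf_ge0// subr_ge0 expr_le1.
  - by apply: mpoly_pdf; apply: measurable_funB => //; exact: measurable_funX.
have -> : (\int[mu]_(x in `[1%R, +oo[) (x ^+ 2 * pdf x)%:E =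
    \int[mu]_(x in `[1%R, +oo[) (pdf x)%:E + (pdf 1)%:E)%E.
  rewrite -integral_1y -ge0_integralD//=.
  - by apply: eq_integral => x _; rewrite -EFinD; congr (_%:E); ring.
  - exact: mpdf.
  - move=> x; rewrite in_itv/= andbT => x1.
    rewrite lee_fin mulr_ge0 ?normal_pdf_ge0// subr_ge0.
    by rewrite -[leLHS](expr1n _ 2) lerXn2r// nnegrE// (le_trans _ x1).
  - by apply: mpoly_pdf; apply: measurable_funB => //; exact: measurable_funX.
by rewrite addeA addeAC.
Qed.

Lemma integral_sqr_std_normal :
  (\int[normal_prob 0 1]_x (x ^+ 2)%:E = 1 :> \bar R)%E.
Proof.
rewrite ge0_integral_normal_prob//=; last 2 first.
- exact/measurable_EFinP/measurable_funX.
- by move=> x; rewrite lee_fin sqr_ge0.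
have even_pdf x : pdf (- x) = pdf x.
  by rewrite normal_pdfE ?oner_neq0// /normal_fun !subr0 sqrrN.
under eq_integral do rewrite -EFinM.
(* Both integrands are even, so the integrals over the line reduce to those over the half-line. *)
rewrite ge0_symfun_integralT//.
- rewrite integral_sqr_pdf_0y -ge0_symfun_integralT//.
  + exact: integral_normal_pdf.
  + by move=> x; exact: normal_pdf_ge0.
  + by move=> x /=; rewrite even_pdf.
- by move=> x; rewrite mulr_ge0 ?sqr_ge0 ?normal_pdf_ge0.
- by move=> x /=; rewrite sqrrN even_pdf.
Qed.

End second_moment.

(** * Symmetry, mean and half-line probabilities of normal laws *)

Section gaussian_moments.
Context {R : realType}.
Local Notation N01 := (@normal_prob R 0 1).

Lemma normal_prob0N (s : R) (A : set R) :
  s != 0 -> normal_prob 0 (- s) A = normal_prob 0 s A.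
Proof.
move=> s0; apply: eq_integral => x _.
by rewrite !normal_pdfE ?oppr_eq0// /normal_peak /normal_fun sqrrN.
Qed.

Lemma std_normal_sym (A : set R) : measurable A -> N01 (-%R @^-1` A) = N01 A.
Proof.
move=> mA; rewrite -[RHS]normal_prob0N ?oner_neq0//.
rewrite (@normal_prob_affine _ 0 (- 1)) ?oppr_eq0 ?oner_neq0//.
by congr (normal_prob 0 1 (_ @^-1` A)); apply/funext => x; rewrite mulN1r addr0.
Qed.

(** Domination by |f| <= 1 + f^2, where constants are integrable because the measure is finite. *)
Lemma sqr_integrable_integrable d (T : measurableType d)
    (mu : {finite_measure set T -> \bar R}) (f : T -> R) :
  measurable_fun [set: T] f -> (\int[mu]_x (f x ^+ 2)%:E < +oo)%E ->
  mu.-integrable [set: T] (EFin \o f).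
Proof.
move=> mf f2.
apply: (@le_integrable _ _ _ mu _ measurableT _
    (fun x => (1 + f x ^+ 2)%:E)).
- exact/measurable_EFinP.
- move=> x _; rewrite /= lee_fin [leRHS]ger0_norm ?addr_ge0 ?sqr_ge0//.
  rewrite ler_norml; apply/andP; split; nra.
- apply: (eq_integrable measurableT (fun x => 1%:E + (f x ^+ 2)%:E)%E) => //.
  apply: integrableD => //.
    exact: finite_measure_integrable_cst.
  apply/integrableP; split; first exact/measurable_EFinP/measurable_funX.
  by under eq_integral do rewrite gee0_abs ?lee_fin ?sqr_ge0//.
Qed.

Lemma integrable_id_std_normal :
  (@normal_prob R 0 1).-integrable [set: R] (EFin \o idfun).
Proof.
apply: sqr_integrable_integrable; first exact: measurable_id.
by rewrite integral_sqr_std_normal ltry.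
Qed.

(** By symmetry the mean equals its opposite; integrability makes it finite, so it must vanish. *)
Lemma integral_id_std_normal : (\int[N01]_x x%:E = 0)%E.
Proof.
have iid := integrable_id_std_normal.
have fin : (\int[N01]_x x%:E)%E \is a fin_num by exact: integrable_fin_num.
have mN : measurable_fun [set: measurableTypeR R]
    (-%R : measurableTypeR R -> measurableTypeR R) by exact: oppr_measurable.
have : (\int[N01]_x x%:E = - \int[N01]_x x%:E)%E.
  transitivity (\int[pushforward N01 (-%R : _ -> measurableTypeR R)]_x x%:E)%E.
    by apply: eq_measure_integral => A mA _; exact/esym/std_normal_sym.
  rewrite integral_pushforward//=; last first.
    rewrite preimage_setT.
    by move: (integrableN iid); apply: eq_integrable.
  rewrite preimage_setT; under eq_integral do rewrite EFinN.
  rewrite integralN//; exact: integrable_add_def.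
move=> /(congr1 fine); rewrite fineN => h.
by rewrite -(fineK fin); congr EFin; lra.
Qed.

Lemma std_normal_itv_gt0 (a b : R) : a < b -> (0 < N01 `]a, b])%E.
Proof.
move=> ab.
(* A lower bound of the density on ]a, b], where x^2 / 2 <= a^2 + b^2. *)
pose c : R := normal_peak 1 * expR (- (a ^+ 2 + b ^+ 2)).
have c0 : 0 < c by rewrite mulr_gt0 ?expR_gt0 ?normal_peak_gt0 ?oner_neq0.
have ba0 : 0 < b - a by rewrite subr_gt0.
apply: (@lt_le_trans _ _ (c * (b - a))%:E).
  by rewrite lte_fin mulr_gt0.
have -> : (c * (b - a))%:E = (\int[lebesgue_measure]_(x in `]a, b]) c%:E)%E.
  by rewrite integral_cst//= lebesgue_measure_itv/= lte_fin ab.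
apply: ge0_le_integral => //=.
- by move=> x _; rewrite lee_fin ltW.
- apply: measurable_funTS; apply/measurable_EFinP.
  exact: measurable_normal_pdf.
- move=> x; rewrite in_itv/= => /andP[ax xb]; rewrite lee_fin.
  rewrite normal_pdfE ?oner_neq0// /normal_fun subr0 ler_pM2l; last first.
    by rewrite normal_peak_gt0 ?oner_neq0.
  rewrite ler_expR expr1n mulNr lerN2.
  have [x0|x0] := lerP 0 (x : R); nra.
Qed.

Lemma normal_prob_itv (m s : R) (c : R) : 0 < s ->
  normal_prob m s `]-oo, c] = N01 `]-oo, (c - m) / s].
Proof.
move=> s0; rewrite normal_prob_affine ?gt_eqF//; congr (N01 _).
apply/seteqP; split => x /=; rewrite !in_itv/=;
by rewrite ler_pdivlMr// lerBrDr mulrC.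
Qed.

Lemma normal_prob_itvy (m s : R) (c : R) : 0 < s ->
  normal_prob m s `]c, +oo[ = N01 `]-oo, (m - c) / s].
Proof.
move=> s0.
rewrite normal_prob_affine ?gt_eqF// -std_normal_sym//; last first.
  rewrite -[X in measurable X]setTI.
  exact: (measurable_affine m s).
(* Reflection turns the open upper tail into an open lower one; the endpoint is then added at no
   cost, the law having a density. *)
rewrite (_ : _ @^-1` _ = `]-oo, (m - c) / s[%classic); last first.
  apply/seteqP; split => x /=; rewrite !in_itv/= andbT ltr_pdivlMr// => h;
    by lra.
by rewrite /normal_prob integral_itv_bndo_bndc//; apply: measurable_funTS;
  apply/measurable_EFinP; exact: measurable_normal_pdf.
Qed.

Lemma normal_prob_pos_half (m s : R) : 0 < s ->
  (normal_prob m s `]-oo, 0%R] < normal_prob m s `]0%R, +oo[)%E = (0 < m).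
Proof.
move=> s0; rewrite normal_prob_itv// normal_prob_itvy// sub0r subr0 mulNr.
(* The two probabilities are now Q(- m / s) and Q(m / s), so strict monotonicity of Q decides by the
   sign of m. *)
have mono (a b : R) : a < b -> (N01 `]-oo, a] < N01 `]-oo, b])%E.
  move=> ab.
  have -> : `]-oo, b]%classic = `]-oo, a] `|` `]a, b]%classic.
    by rewrite -itv_bndbnd_setU// bnd_simp ltW.
  rewrite measureU//; last first.
    rewrite -subset0 => x [] /=; rewrite !in_itv/= => xa.
    by rewrite ltNge xa.
  by rewrite lteDl ?fin_num_measure// std_normal_itv_gt0.
have [m0|m0|->] := ltrgt0P m.
- by apply: mono; rewrite -mulNr ltr_pM2r ?invr_gt0//; lra.
- apply/negbTE; rewrite -leNgt ltW//; apply: mono.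
  by rewrite -mulNr ltr_pM2r ?invr_gt0//; lra.
- by rewrite mul0r oppr0 ltxx.
Qed.

End gaussian_moments.

(** * Identification of a normal law from its first two moments *)

Section gaussian_variable.
Context {R : realType} d (Omega : measurableType d) (P : probability Omega R).

Lemma normal_law_moments (X : {RV P >-> R}) (m v q : R) : 0 <= v -> 0 < q ->
  (forall A : set R, measurable A ->
    P [set w | A (X w)] = normal_law m v A) ->
  'E_P[X]%E = 0%E -> 'E_P[X \* X]%E = q%:E -> m = 0 /\ v = q.
Proof.
move=> v0 q0 lawX EX EXX.
have msqr : measurable_fun [set: R] (fun x : R => (x ^+ 2)%:E).
  by apply/measurable_EFinP; exact: measurable_funX.
have sqrE : (\int[distribution P X]_x (x ^+ 2)%:E = q%:E)%E.
  rewrite ge0_integral_distribution//; last first.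
    by move=> x; rewrite lee_fin sqr_ge0.
  by rewrite -EXX unlock.
have iX : P.-integrable [set: Omega] (EFin \o X).
  apply: sqr_integrable_integrable => //.
  by move: EXX; rewrite unlock => /= ->; rewrite ltry.
have idE : (\int[distribution P X]_x x%:E = 0)%E.
  by rewrite integral_distribution// -EX unlock.
have distE : forall A, measurable A -> distribution P X A = normal_law m v A by [].
(* In the Dirac case the mean forces [m = 0], so the second moment is 0, contradicting [0 < q]. *)
have [vE|v_neq0] := eqVneq v 0.
  have distD (f : R -> \bar R) : measurable_fun [set: R] f ->
      (\int[distribution P X]_x f x = f m)%E.
    move=> mf; transitivity (\int[dirac m]_x f x)%E.
      apply: eq_measure_integral => A mA _.
      by apply: (etrans (distE A mA)); rewrite /normal_law vE eqxx.
    by rewrite integral_dirac// diracT mul1e.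
  move: idE; rewrite distD// => -[m0].
  move: sqrE; rewrite distD// m0 expr0n/= => -[q0'].
  by move: q0; rewrite -q0' ltxx.
pose s := Num.sqrt v.
have v_gt0 : 0 < v by rewrite lt_neqAle eq_sym v_neq0.
have s0 : 0 < s by rewrite sqrtr_gt0.
pose F : measurableTypeR R -> R := fun x => s * x + m.
have mF : measurable_fun [set: measurableTypeR R] F by exact: measurable_affine.
(* Otherwise the law of [X] is the image of N(0, 1) under [F], and its moments follow from those of
   N(0, 1). *)
have distN (f : R -> \bar R) :
    (\int[distribution P X]_x f x = \int[pushforward (normal_prob 0 1) F]_x f x)%E.
  apply: eq_measure_integral => A mA _; apply: (etrans (distE A mA)).
  by rewrite /normal_law (negbTE v_neq0) normal_prob_affine// gt_eqF.
have iid := @integrable_id_std_normal R.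
have iF : (normal_prob 0 1).-integrable [set: measurableTypeR R] (EFin \o F).
  have icst : (normal_prob 0 1).-integrable [set: measurableTypeR R] (EFin \o cst m).
    exact: finite_measure_integrable_cst.
  have := integrableD measurableT (integrableZl measurableT s iid) icst.
  by apply: eq_integrable.
have m0 : m = 0.
  move: idE; rewrite distN integral_pushforward//= preimage_setT /F.
  under eq_integral do rewrite EFinD EFinM.
  rewrite integralD//=; last 2 first.
  - exact: integrableZl.
  - exact: finite_measure_integrable_cst.
  rewrite integralZl//= integral_id_std_normal mule0 add0e integral_cst//=.
  by rewrite [X in (_ * X)%E]probability_setT mule1 => -[].
split=> //; move: sqrE.
rewrite distN ge0_integral_pushforward//=; last first.
  by move=> x _; rewrite lee_fin sqr_ge0.
rewrite preimage_setT /F m0.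
under eq_integral do rewrite addr0 exprMn EFinM.
rewrite ge0_integralZl//=; last 2 first.
- by move=> x _; rewrite lee_fin sqr_ge0.
- by rewrite lee_fin sqr_ge0.
by rewrite integral_sqr_std_normal mule1 sqr_sqrtr// => -[].
Qed.

End gaussian_variable.

(** * Inner products and Borel half-spaces *)

Section inner_product.
Context {R : realType} (H : hilbertType R).
Implicit Types x y z : H.

Lemma innerDl x y z : inner (x + y) z = inner x z + inner y z.
Proof. by have := inner_linearl z 1 x y; rewrite scale1r mul1r. Qed.

Lemma innerZl a x z : inner (a *: x) z = a * inner x z.
Proof.
have i0 : inner (0 : H) z = 0.
  by have := innerDl 0 0 z; rewrite addr0 => h; lra.
by have := inner_linearl z a x 0; rewrite !addr0 i0 addr0.
Qed.

Lemma innerDr x y z : inner z (x + y) = inner z x + inner z y.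
Proof. by rewrite innerC innerDl !(innerC _ z). Qed.

Lemma innerZr a x z : inner z (a *: x) = a * inner z x.
Proof. by rewrite innerC innerZl (innerC _ z). Qed.

Lemma innerBr x y z : inner z (x - y) = inner z x - inner z y.
Proof. by rewrite -scaleN1r innerDr innerZr mulN1r. Qed.

(** Polarization expresses the inner product through the norm, which is continuous. *)
Lemma continuous_innerr x : continuous (inner x : H -> R).
Proof.
have -> : inner x = (fun y => (`|x + y| ^+ 2 - `|x| ^+ 2 - `|y| ^+ 2) / 2).
  apply/funext => y.
  rewrite -!inner_norm innerDl !innerDr (innerC y x).
  by field.
move=> y; apply: cvgMl; apply: (@cvgB _ R^o).
  apply: (@cvgB _ R^o); last exact: cvg_cst.
  apply: (cvg_comp _ (fun r : R => r ^+ 2)); last exact: sqr_continuous.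
  by apply: cvg_norm; apply: cvgD; [exact: cvg_cst|exact: cvg_id].
apply: (cvg_comp _ (fun r : R => r ^+ 2)); last exact: sqr_continuous.
exact: norm_continuous.
Qed.

Lemma measurable_half_H x : measurable (half_H x).
Proof.
rewrite -[half_H x]setCK; apply: measurableC; apply: sub_sigma_algebra.
rewrite openC.
by apply: (closed_comp _ (@closed_le _ 0)) => y _; exact: continuous_innerr.
Qed.

Lemma measurable_half_K x : measurable (half_K x).
Proof.
have -> : half_K x = ~` half_H x.
  by apply/seteqP; split => y /=; rewrite /half_K /half_H /= ltNge => /negP.
by apply: measurableC; exact: measurable_half_H.
Qed.

End inner_product.

Lemma ae_eq_measure d (T : measurableType d) (R : realType)
    (mu : {measure set T -> \bar R}) (A B : set T) :
  measurable A -> measurable B -> {ae mu, forall x, A x <-> B x} -> mu A = mu B.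
Proof.
move=> mA mB AB.
rewrite -(setIT A) -(setIT B) -!integral_indic//.
apply: (@ge0_ae_eq_integral _ _ _ mu setT (EFin \o \1_A) (EFin \o \1_B)) => //.
- exact/measurable_EFinP/measurable_indic.
- exact/measurable_EFinP/measurable_indic.
- by move=> x _; rewrite lee_fin.
- by move=> x _; rewrite lee_fin.
apply: filterS AB => x ABx _; rewrite /= !indicE; congr (_%:R%:E); congr nat_of_bool.
by apply/idP/idP; rewrite !inE => /ABx.
Qed.

(** * The regularized inverse and the threshold form of the test *)

Section regularized_inverse.
Context {R : realType} (X Y : hilbertType R).
Variables (T : X -> Y) (Ts : Y -> X) (S : {linear X -> X}) (sigma : R).
Variable Ainv : X -> X.
Hypotheses (T_adj : is_adjoint T Ts) (S_sa : self_adjoint S).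
Hypothesis Ainv_K : cancel Ainv (regularized_op T Ts S sigma).

(** This form is visibly symmetric and positive, which yields both the symmetry of [Ainv] and the
    positivity of the posterior variance. *)
Lemma inner_regularized_op x y :
  inner x (regularized_op T Ts S sigma y) =
  inner (T (S x)) (T (S y)) + sigma ^+ 2 * inner x y.
Proof. by rewrite /regularized_op innerDr innerZr -S_sa -T_adj. Qed.

Lemma inner_Ainv x y : inner (Ainv x) y = inner x (Ainv y).
Proof.
rewrite -{1}[y]Ainv_K -{2}[x]Ainv_K [RHS]innerC !inner_regularized_op.
by rewrite (innerC (T _)) (innerC (Ainv x)).
Qed.

Lemma posterior_variance_gt0 phi : 0 < sigma -> Phi_MAP T S Ainv phi != 0 ->
  0 < inner (posterior_cov S sigma Ainv phi) phi.
Proof.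
move=> sigma0 Phi0; rewrite /posterior_cov innerZl S_sa -{2}[S phi]Ainv_K.
(* With w = [Ainv (S phi)], what remains is |T S w|^2 + sigma^2 |w|^2, where T S w is [Phi_MAP] and
   hence nonzero. *)
rewrite mulr_gt0 ?exprn_gt0// inner_regularized_op !inner_norm.
apply: ltr_pwDl; last by rewrite mulr_ge0 ?sqr_ge0.
by rewrite exprn_gt0// normr_gt0.
Qed.

Lemma inner_posterior_mean m0 (y : data Y) m phi :
  is_posterior_mean T S m0 Ainv y m ->
  let Phi := Phi_MAP T S Ainv phi in
  inner m phi = y Phi - inner m0 (Ts Phi - phi).
Proof.
(* Moving [S] and [Ainv] onto [phi] allows the Riesz property of [r] to be applied at
   [Ainv (S phi)]. *)
move=> [r [rE ->]] /=; rewrite innerDl S_sa inner_Ainv rE T_adj innerBr.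
by rewrite /Phi_MAP; ring.
Qed.

Lemma MAP_testE m0 (y : data Y) m phi (Post : R.-pker (data Y) ~> (borel X)) :
  0 < sigma -> is_posterior_mean T S m0 Ainv y m ->
  is_gaussian_measure m (posterior_cov S sigma Ainv) (Post y) ->
  let Phi := Phi_MAP T S Ainv phi in Phi != 0 ->
  MAP_test Post phi y = (inner m0 (Ts Phi - phi) < y Phi).
Proof.
move=> sigma0 ym gauss Phi Phi0; rewrite /MAP_test.
have v0 := posterior_variance_gt0 sigma0 Phi0.
have lawE (A : set R) : measurable A ->
    Post y [set x | A (inner phi x)] =
    normal_prob (inner m phi)
      (Num.sqrt (inner (posterior_cov S sigma Ainv phi) phi)) A.
  move=> mA; have := gauss phi A mA; rewrite /normal_law gt_eqF// => <-.
  by congr (Post y _); apply/seteqP; split => x /=; rewrite innerC.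
have -> : half_H phi = [set x | `]-oo, 0%R]%classic (inner phi x)].
  by apply/seteqP; split => x /=; rewrite in_itv.
have -> : half_K phi = [set x | `]0%R, +oo[%classic (inner phi x)].
  by apply/seteqP; split => x /=; rewrite in_itv/= andbT.
rewrite !lawE// normal_prob_pos_half ?sqrtr_gt0//.
by rewrite (inner_posterior_mean phi ym) subr_gt0.
Qed.

End regularized_inverse.

(** * Measurability of the test, one-dimensional white noise, and the size *)

Lemma measurable_MAP_test (R : realType) (X Y : hilbertType R)
    (Post : R.-pker (data Y) ~> (borel X)) (phi : X) :
  measurable [set y : data Y | MAP_test Post phi y = true].
Proof.
have mH := measurable_kernel Post (half_H phi) (measurable_half_H phi).
have mK := measurable_kernel Post (half_K phi) (measurable_half_K phi).
rewrite -[X in measurable X]setTI.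
exact: emeasurable_fun_lt.
Qed.

Lemma white_noise_law (R : realType) (Y : hilbertType R)
    d (Omega : measurableType d) (P : probability Omega R)
    (Z : Y -> {RV P >-> R}) (g : Y) (A : set R) :
  is_white_noise Z -> g != 0 -> measurable A ->
  P [set w | A (Z g w)] = normal_prob 0 `|g| A.
Proof.
move=> [_ EZ gaussZ covZ] g0 mA.
(* The linear combination with one term and coefficient 1; its unknown parameters are then fixed by
   the moments of [Z g]. *)
have [m [v [v0 lawZ]]] := gaussZ 1 (fun=> g) (fun=> 1).
have {}lawZ (B : set R) : measurable B -> P [set w | B (Z g w)] = normal_law m v B.
  move=> mB; rewrite -lawZ//; congr (P _).
  by apply/seteqP; split => w /=; rewrite big_ord1 mul1r.
have g2 : 0 < inner g g by rewrite inner_norm exprn_gt0// normr_gt0.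
have [m0 vE] := normal_law_moments v0 g2 lawZ (EZ g) (covZ g g).
rewrite lawZ// /normal_law m0 vE gt_eqF// inner_norm sqrtr_sqr.
by rewrite normr_id.
Qed.

Theorem theorem2p5 (R : realType) (X Y : hilbertType R)
  (sepX : separable X) (sepY : separable Y)
  (phi m0 : X) (sigma : R) (sigma_gt0 : 0 < sigma)
  (* the bounded operator T and its adjoint *)
  (T : {linear X -> Y}) (T_bounded : continuous T)
  (Ts : {linear Y -> X}) (T_adj : is_adjoint T Ts)
  (* the prior covariance, its square root, and the inverse of the operator
     C0^(1/2) T^* T C0^(1/2) + sigma^2 Id *)
  (C0 : {linear X -> X}) (C0_bounded : continuous C0)
  (C0_sa : self_adjoint C0) (C0_pos : positive_definite C0)
  (C0_tr : trace_class C0)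
  (S : {linear X -> X}) (S_sqrt : is_sqrt_op C0 S)
  (Ainv : X -> X)
  (AinvK : cancel (regularized_op T Ts S sigma) Ainv)
  (Ainv_K : cancel Ainv (regularized_op T Ts S sigma))
  (* Gaussian white noise on Y *)
  (d : measure_display) (Omega : measurableType d) (P : probability Omega R)
  (Z : Y -> {RV P >-> R}) (Z_white : is_white_noise Z)
  (* prior N(m0, C0) and posterior, the latter being almost surely N(m, C) *)
  (prior : probability (borel X) R)
  (prior_gauss : is_gaussian_measure m0 C0 prior)
  (Post : R.-pker (data Y) ~> (borel X))
  (Post_posterior : is_posterior T sigma Z prior Post)
  (Post_gauss : forall u : X, {ae P, forall w : Omega,
     exists m : X, is_posterior_mean T S m0 Ainv (observe T sigma Z u w) m /\
       is_gaussian_measure m (posterior_cov S sigma Ainv)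
         (Post (observe T sigma Z u w))})
  (u : X)
  (* the right-hand side divides by the norm of Phi_MAP *)
  (Phi_neq0 : Phi_MAP T S Ainv phi != 0) :
  let Phi := Phi_MAP T S Ainv phi in
  data_law T sigma Z u [set y : data Y | MAP_test Post phi y = true] =
  std_normal_cdf
    ((inner u (Ts Phi) - inner m0 (Ts Phi - phi)) / (sigma * `|Phi|)).
Proof.
move=> Phi; have [_ S_sa _ _] := S_sqrt.
have normPhi : 0 < `|Phi| by rewrite normr_gt0.
(* The threshold for the noise, obtained by solving <u, T^* Phi> + sigma Z(Phi) > <m0, T^* Phi -
   phi> for Z(Phi). *)
pose c := (inner m0 (Ts Phi - phi) - inner u (Ts Phi)) / sigma.
have mMAP := measurable_MAP_test Post phi.
have mZ : measurable [set w | `]c, +oo[%classic (Z Phi w)].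
  exact: (measurable_funPTI (Z Phi) (measurable_itv `]c, +oo[)).
transitivity (P [set w | `]c, +oo[%classic (Z Phi w)]).
  (* The two events are compared only almost surely, since the posterior is known to be Gaussian
     only there. *)
  apply: (@ae_eq_measure _ _ _ P (observe T sigma Z u @^-1`
      [set y | MAP_test Post phi y = true])) => //.
    by rewrite -[X in measurable X]setTI; exact: measurable_observe.
  have := Post_gauss u; apply: filterS => w [m [ym gauss]].
  rewrite /= (MAP_testE T_adj S_sa Ainv_K sigma_gt0 ym gauss Phi_neq0).
  rewrite in_itv/= andbT /c ltr_pdivrMr// /observe T_adj ltrBlDl.
  by rewrite (mulrC sigma).
(* The upper tail of N(0, |Phi|^2) beyond [c] is Q(- c / |Phi|), which accounts for the sign in the
   final formula. *)
rewrite (white_noise_law Z_white)// normal_prob_itvy// /std_normal_cdf.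
suff -> : (0 - c) / `|Phi| =
    (inner u (Ts Phi) - inner m0 (Ts Phi - phi)) / (sigma * `|Phi|) by [].
by rewrite /c; field; rewrite !gt_eqF.
Qed.
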